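(* Let $R$ be a ring whose nilradical is a prime ideal (e.g. an integral domain). If $R$ is of any one of the following types, then $\operatorname{udim} R=1$: (1) $R$ is a semilocal ring such that all maximal ideals have positive height (e.g. a local ring of positive Krull dimension). (2) $R$ is a G-domain that is not a field. (3) $R=A[[X]]$ is the formal power series ring in an analytic indeterminate $X$ over a nonzero ring $A$. (4) $R$ is a subring of $T$ that contains $\mathfrak{m}$, where $(T,\mathfrak{m})$ is a local ring of positive Krull dimension.
   Context: All rings are commutative and unital. Semilocal means having only finitely many maximal ideals, local means having exactly one; no Noetherian hypothesis is assumed. A G-domain is an integral domain that has a nonzero element contained in every nonzero prime ideal. A ring $R$ is unit-additive if whenever $u,v$ are units of $R$, $u+v$ is either a unit of $R$ or a nilpotent element. The saturation of a multiplicative set $W\subseteq R$ is $\widetilde W=\{x\in R\mid \exists y\in R,\ xy\in W\}$. Unit dimension: let $R$ be a ring whose nilradical is a prime ideal. Set $W_0=\{1\}$ and $V_0=\widetilde{W_0}=U(R)$ (the units of $R$). For each $i\ge1$ define inductively $W_i$ to be the set of non-nilpotent (finite) sums of elements of $V_{i-1}$ (this set is multiplicatively closed) and $V_i=\widetilde{W_i}$. Then $\operatorname{udim} R$ is the smallest integer $n\ge0$ such that $W_n^{-1}R$ is unit-additive, and $\operatorname{udim} R=\infty$ if no such $n$ exists. *)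

(* Defs.v *)
From HB Require Import structures.
From mathcomp Require Import all_boot all_order all_algebra.
From mathcomp Require Import generic_quotient ring_quotient.
From mathcomp Require Import boolp classical_sets cardinality.
From mathcomp Require Import ring.

Set Implicit Arguments.
Unset Strict Implicit.
Unset Printing Implicit Defensive.

Import GRing.Theory.
Local Open Scope ring_scope.
Local Open Scope classical_set_scope.
Local Open Scope quotient_scope.

Inductive enat := Fin of nat | Infty.

Definition epos (e : enat) : bool := if e is Fin n then (0 < n)%N else true.

Lemma asbool_ex (E : set nat) : (exists n, E n) -> exists n, `[< E n >].
Proof. by case=> n En; exists n; apply/asboolP. Qed.

(* Infimum in {0, 1, ..., oo}, so oo on the empty set. *)
Definition einf (E : set nat) : enat :=
  if pselect (exists n, E n) is left exE then Fin (ex_minn (asbool_ex exE))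
  else Infty.

(* Supremum in {0, 1, ..., oo}, so 0 on the empty set. *)
Definition esup (E : set nat) : enat := einf [set m | forall n, E n -> (n <= m)%N].

Lemma einf_FinP (E : set nat) n :
  einf E = Fin n <-> E n /\ forall m, E m -> (n <= m)%N.
Proof.
rewrite /einf; case: pselect => [exE|nE]; last first.
  by split=> // -[En _]; case: nE; exists n.
case: ex_minnP => k /asboolP Ek kmin; split=> [[<-]|[En nmin]].
  by split=> // m Em; apply: kmin; apply/asboolP.
congr Fin; apply/eqP; rewrite eqn_leq nmin // andbT.
by apply: kmin; apply/asboolP.
Qed.

Lemma einf_InftyP (E : set nat) : einf E = Infty <-> forall n, ~ E n.
Proof.
rewrite /einf; case: pselect => [[n En]|nE]; first by split=> // /(_ _ En).
by split=> // _ n En; apply: nE; exists n.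
Qed.

Section Rings.
Variable R : comPzRingType.
Implicit Types (x y : R) (W : set R).

(* The library's [GRing.unit] is only available on rings that carry a
   [unitRingType] structure. *)
Definition is_unit x := exists y, x * y = 1.

Definition nilradical : set R := [set x | exists n, x ^+ n = 0].

Definition unit_additive :=
  forall x y, is_unit x -> is_unit y -> is_unit (x + y) \/ nilradical (x + y).

Definition saturation W : set R := [set x | exists y, W (x * y)].

(* In the recursive clause, [saturation (Wset j)] is V_j. *)
Fixpoint Wset (i : nat) : set R :=
  if i is j.+1 then
    [set x | ~ nilradical x /\
       exists s : seq R, (forall y, y \in s -> saturation (Wset j) y) /\
                         x = \sum_(y <- s) y]
  else [set 1].

End Rings.

Arguments nilradical : clear implicits.
Arguments unit_additive : clear implicits.
Arguments Wset : clear implicits.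

Section Localization.
Variables (R : comPzRingType) (W : set R) (closedW : mulr_closed [in W]).

Let W1 : W 1. Proof. by case: closedW => + _; rewrite inE. Qed.

Let WM x y : W x -> W y -> W (x * y).
Proof.
by move=> Wx Wy; case: closedW => _ /(_ x y); rewrite !inE; apply.
Qed.

Let Wval (s : W) : W (val s). Proof. by have := valP s; rewrite inE. Qed.

Definition den1 : W := exist _ 1 (mem_set W1).
Definition denM (s t : W) : W :=
  exist _ (val s * val t) (mem_set (WM (Wval s) (Wval t))).

Definition loc_rel (u v : R * W) : bool :=
  `[< exists2 w, W w & w * (u.1 * val v.2 - v.1 * val u.2) = 0 >].

Fact loc_rel_refl : reflexive loc_rel.
Proof. by move=> u; apply/asboolP; exists 1; rewrite // subrr mulr0. Qed.

Fact loc_rel_sym : symmetric loc_rel.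
Proof.
suff sub u v : loc_rel u v -> loc_rel v u by move=> u v; apply/idP/idP; apply: sub.
move=> /asboolP[w Ww e]; apply/asboolP; exists w => //.
by rewrite -opprB mulrN e oppr0.
Qed.

Fact loc_rel_trans : transitive loc_rel.
Proof.
move=> [b t] [a s] [c r] /asboolP[/= w Ww e] /asboolP[/= w' Ww' e'].
apply/asboolP; exists (w * w' * val t) => /=; first exact: WM (WM _ _) (Wval _).
transitivity (w' * val r * (w * (a * val t - b * val s))
   + w * val s * (w' * (b * val r - c * val t))); first by rewrite /=; ring.
by rewrite e e' !mulr0 addr0.
Qed.

Canonical loc_equiv := EquivRel loc_rel loc_rel_refl loc_rel_sym loc_rel_trans.

Definition localization := {eq_quot loc_equiv}.
HB.instance Definition _ := Choice.on localization.

Definition frac (x : R) (s : W) : localization := \pi_localization (x, s).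

Lemma frac_eqP x s y t :
  frac x s = frac y t <-> exists2 w, W w & w * (x * val t - y * val s) = 0.
Proof.
rewrite /frac; split=> [/eqmodP/asboolP //|h].
by apply/eqmodP; apply/asboolP.
Qed.

Lemma frac_eq x s y t : x * val t = y * val s -> frac x s = frac y t.
Proof. by move=> e; apply/frac_eqP; exists 1; rewrite // e subrr mulr0. Qed.

Lemma fracP (p : localization) : exists x s, p = frac x s.
Proof.
by exists (repr p).1, (repr p).2; rewrite /frac -surjective_pairing reprK.
Qed.

Definition loc_add (p q : localization) : localization :=
  let: (x, s) := repr p in let: (y, t) := repr q in
  frac (x * val t + y * val s) (denM s t).

Definition loc_mul (p q : localization) : localization :=
  let: (x, s) := repr p in let: (y, t) := repr q in frac (x * y) (denM s t).

Definition loc_opp (p : localization) : localization :=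
  let: (x, s) := repr p in frac (- x) s.

Lemma repr_frac x s : let: (y, t) := repr (frac x s) in frac y t = frac x s.
Proof. by case E: (repr _) => [y t]; rewrite /frac -E reprK. Qed.

Lemma loc_addE x s y t :
  loc_add (frac x s) (frac y t) = frac (x * val t + y * val s) (denM s t).
Proof.
rewrite /loc_add; have := repr_frac x s; have := repr_frac y t.
case: (repr _) => b t'; case: (repr _) => a s'.
move=> /frac_eqP[w' Ww' e'] /frac_eqP[w Ww e].
apply/frac_eqP; exists (w * w'); first exact: WM.
transitivity (w' * val t * val t' * (w * (a * val s - x * val s'))
   + w * val s * val s' * (w' * (b * val t - y * val t'))).
  by rewrite /=; ring.
by rewrite e e' !mulr0 addr0.
Qed.

Lemma loc_mulE x s y t :
  loc_mul (frac x s) (frac y t) = frac (x * y) (denM s t).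
Proof.
rewrite /loc_mul; have := repr_frac x s; have := repr_frac y t.
case: (repr _) => b t'; case: (repr _) => a s'.
move=> /frac_eqP[w' Ww' e'] /frac_eqP[w Ww e].
apply/frac_eqP; exists (w * w'); first exact: WM.
transitivity (w' * b * val t * (w * (a * val s - x * val s'))
   + w * x * val s' * (w' * (b * val t - y * val t'))).
  by rewrite /=; ring.
by rewrite e e' !mulr0 addr0.
Qed.

Lemma loc_oppE x s : loc_opp (frac x s) = frac (- x) s.
Proof.
rewrite /loc_opp; have := repr_frac x s; case: (repr _) => a s'.
move=> /frac_eqP[w Ww e]; apply/frac_eqP; exists w => //.
by rewrite !mulNr -opprD mulrN e oppr0.
Qed.

Fact loc_addA : associative loc_add.
Proof.
move=> p q r; have [x [s ->]] := fracP p; have [y [t ->]] := fracP q.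
by have [z [u ->]] := fracP r; rewrite !loc_addE; apply: frac_eq => /=; ring.
Qed.

Fact loc_addC : commutative loc_add.
Proof.
move=> p q; have [x [s ->]] := fracP p; have [y [t ->]] := fracP q.
by rewrite !loc_addE; apply: frac_eq => /=; ring.
Qed.

Fact loc_add0 : left_id (frac 0 den1) loc_add.
Proof.
move=> p; have [x [s ->]] := fracP p.
by rewrite loc_addE; apply: frac_eq => /=; ring.
Qed.

Fact loc_addN : left_inverse (frac 0 den1) loc_opp loc_add.
Proof.
move=> p; have [x [s ->]] := fracP p.
by rewrite loc_oppE loc_addE; apply: frac_eq => /=; ring.
Qed.

HB.instance Definition _ :=
  GRing.isZmodule.Build localization loc_addA loc_addC loc_add0 loc_addN.

Fact loc_mulA : associative loc_mul.
Proof.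
move=> p q r; have [x [s ->]] := fracP p; have [y [t ->]] := fracP q.
by have [z [u ->]] := fracP r; rewrite !loc_mulE; apply: frac_eq => /=; ring.
Qed.

Fact loc_mulC : commutative loc_mul.
Proof.
move=> p q; have [x [s ->]] := fracP p; have [y [t ->]] := fracP q.
by rewrite !loc_mulE; apply: frac_eq => /=; ring.
Qed.

Fact loc_mul1 : left_id (frac 1 den1) loc_mul.
Proof.
move=> p; have [x [s ->]] := fracP p.
by rewrite loc_mulE; apply: frac_eq => /=; ring.
Qed.

Fact loc_mulDl : left_distributive loc_mul (+%R : localization -> _).
Proof.
move=> p q r; have [x [s ->]] := fracP p; have [y [t ->]] := fracP q.
have [z [u ->]] := fracP r.
change (loc_mul (loc_add (frac x s) (frac y t)) (frac z u) =
  loc_add (loc_mul (frac x s) (frac z u)) (loc_mul (frac y t) (frac z u))).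
by rewrite loc_addE !loc_mulE loc_addE; apply: frac_eq => /=; ring.
Qed.

HB.instance Definition _ := GRing.Zmodule_isComPzRing.Build localization
  loc_mulA loc_mulC loc_mul1 loc_mulDl.

Lemma frac0 : 0 = frac 0 den1. Proof. by []. Qed.

Lemma frac1 : 1 = frac 1 den1. Proof. by []. Qed.

Lemma fracD x s y t :
  frac x s + frac y t = frac (x * val t + y * val s) (denM s t).
Proof. exact: loc_addE. Qed.

Lemma fracM x s y t : frac x s * frac y t = frac (x * y) (denM s t).
Proof. exact: loc_mulE. Qed.

End Localization.

Section PowerSeries.
Variable A : comPzRingType.

Record powerseries := PowerSeries { coefs : nat -> A }.

HB.instance Definition _ := gen_eqMixin powerseries.
HB.instance Definition _ := gen_choiceMixin powerseries.

Implicit Types f g h : powerseries.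

Lemma coefsP f g : (forall n, coefs f n = coefs g n) -> f = g.
Proof. by case: f g => [f] [g] /= e; congr PowerSeries; apply: funext. Qed.

Definition ps_add f g := PowerSeries (fun n => coefs f n + coefs g n).
Definition ps_opp f := PowerSeries (fun n => - coefs f n).
Definition ps_const (c : A) := PowerSeries (fun n => c *+ (n == 0)%N).
Definition ps_mul f g :=
  PowerSeries (fun n => \sum_(i < n.+1) coefs f i * coefs g (n - i)%N).

Fact ps_addA : associative ps_add.
Proof. by move=> f g h; apply: coefsP => n /=; rewrite addrA. Qed.

Fact ps_addC : commutative ps_add.
Proof. by move=> f g; apply: coefsP => n /=; rewrite addrC. Qed.

Fact ps_add0 : left_id (ps_const 0) ps_add.
Proof. by move=> f; apply: coefsP => n /=; rewrite mul0rn add0r. Qed.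

Fact ps_addN : left_inverse (ps_const 0) ps_opp ps_add.
Proof. by move=> f; apply: coefsP => n /=; rewrite mul0rn addNr. Qed.

HB.instance Definition _ :=
  GRing.isZmodule.Build powerseries ps_addA ps_addC ps_add0 ps_addN.

Let coefs_mul_rev f g n :
  coefs (ps_mul f g) n = \sum_(i < n.+1) coefs f (n - i)%N * coefs g i.
Proof.
rewrite /= (reindex_inj rev_ord_inj) /=.
by apply: eq_bigr => i _; rewrite subSS subKn // -ltnS.
Qed.

Fact ps_mulC : commutative ps_mul.
Proof.
move=> f g; apply: coefsP => n; rewrite coefs_mul_rev /=.
by apply: eq_bigr => i _; rewrite mulrC.
Qed.

Fact ps_mulA : associative ps_mul.
Proof.
move=> f g h; apply: coefsP => n; rewrite [RHS]coefs_mul_rev [LHS]/=.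
pose coef3 j k := coefs f j * (coefs g (n - j - k)%N * coefs h k).
transitivity (\sum_(j < n.+1) \sum_(k < n.+1 | (k <= n - j)%N) coef3 j k).
  apply: eq_bigr => /= j _; have /= -> := coefs_mul_rev g h (n - j).
  rewrite big_distrr /=.
  by rewrite (big_ord_narrow_leq (leq_subr _ _)).
rewrite (exchange_big_dep predT) //=; apply: eq_bigr => k _.
transitivity (\sum_(j < n.+1 | (j <= n - k)%N) coef3 j k).
  apply: eq_bigl => j; rewrite -ltnS -(ltnS j) -!subSn ?leq_ord //.
  by rewrite -subn_gt0 -(subn_gt0 j) -!subnDA addnC.
rewrite (big_ord_narrow_leq (leq_subr _ _)) big_distrl /=.
by apply: eq_bigr => j _; rewrite /coef3 -!subnDA addnC mulrA.
Qed.

Fact ps_mul1 : left_id (ps_const 1) ps_mul.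
Proof.
move=> f; apply: coefsP => n /=.
rewrite big_ord_recl subn0 mul1r big1 ?addr0 // => i _.
by rewrite mulr0n mul0r.
Qed.

Fact ps_mulDl : left_distributive ps_mul (+%R : powerseries -> _).
Proof.
move=> f g h; apply: coefsP => n /=; rewrite -big_split /=.
by apply: eq_bigr => i _; rewrite mulrDl.
Qed.

HB.instance Definition _ := GRing.Zmodule_isComPzRing.Build powerseries
  ps_mulA ps_mulC ps_mul1 ps_mulDl.

Lemma coefsD f g n : coefs (f + g) n = coefs f n + coefs g n.
Proof. by []. Qed.

Lemma coefsM f g n :
  coefs (f * g) n = \sum_(i < n.+1) coefs f i * coefs g (n - i)%N.
Proof. by []. Qed.

Lemma coefs1 n : coefs 1 n = (n == 0)%:R :> A.
Proof. by []. Qed.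

End PowerSeries.

Section Primes.
Variable R : comNzRingType.
Implicit Types I J M P : set R.

(* [idealr_closed] includes properness: it requires that 1 is not a member. *)
Definition prime_ideal P := idealr_closed [in P] /\ prime_idealr_closed [in P].

Definition maximal_ideal M :=
  idealr_closed [in M] /\
  forall J, idealr_closed [in J] -> M `<=` J -> J = M.

Definition prime_chain (n : nat) (C : nat -> set R) :=
  (forall i, (i <= n)%N -> prime_ideal (C i)) /\
  (forall i, (i < n)%N -> C i `<` C i.+1).

Definition height P : enat :=
  esup [set n | exists C, prime_chain n C /\ C n = P].

(* The empty supremum does not arise: R is nonzero, so it has a prime ideal. *)
Definition krull_dim : enat := esup [set n | exists C, prime_chain n C].

Definition semilocal := finite_set [set M | maximal_ideal M].

Definition local_ring M := [set N | maximal_ideal N] = [set M].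

Definition G_domain :=
  GRing.integral_domain_axiom R /\
  exists2 x : R, x != 0 &
    forall P, prime_ideal P -> P <> [set 0] -> P x.

Definition is_field := forall x : R, x != 0 -> is_unit x.

End Primes.

Arguments krull_dim : clear implicits.
Arguments semilocal : clear implicits.
Arguments local_ring : clear implicits.
Arguments G_domain : clear implicits.
Arguments is_field : clear implicits.

Section UnitDimension.
Variable R : comNzRingType.

Lemma WsetM : prime_ideal (nilradical R) ->
  forall i, mulr_closed [in Wset R i].
Proof.
case=> _ nilP; elim=> [|i [W1 WM]].
  split=> [|x y]; first by rewrite !inE.
  by rewrite !inE => -> ->; rewrite mulr1.
rewrite inE in W1.
have {}WM x y : Wset R i x -> Wset R i y -> Wset R i (x * y).
  by move=> Wx Wy; have := WM x y; rewrite !inE; apply.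
split=> [|x y].
  rewrite inE; split; first by case=> n; rewrite expr1n; apply/eqP/oner_neq0.
  exists [:: 1]; rewrite big_seq1; split=> // y; rewrite mem_seq1 => /eqP->.
  by exists 1; rewrite mulr1.
rewrite !inE => -[nx [s [Vs ex]]] [ny [t [Vt ey]]]; split.
  by have := nilP x y; rewrite !inE => nxy /nxy /orP[]; rewrite inE.
exists [seq x * y | x <- s, y <- t]; split; last first.
  rewrite ex ey big_allpairs_dep mulr_suml.
  by apply: eq_bigr => a _; rewrite mulr_sumr.
move=> _ /allpairsP[[a b] /= [/Vs [a' Wa] /Vt [b' Wb] ->]].
by exists (a' * b'); rewrite mulrACA; apply: WM.
Qed.

Definition udim (hR : prime_ideal (nilradical R)) : enat :=
  einf [set n | unit_additive (localization (WsetM hR n))].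

End UnitDimension.

(* Main.v *)
Require Import Defs.
From mathcomp Require Import all_boot all_order all_algebra.
From mathcomp Require Import boolp classical_sets cardinality.
From mathcomp Require Import ring.

(* [fraction] also defines [frac]. *)
Import Defs.
Import GRing.Theory.
Local Open Scope ring_scope.
Local Open Scope classical_set_scope.

(** All four hypotheses produce a non-nilpotent [x] in the Jacobson radical.
Given such an [x], the equation [x = (1 + x) - 1] writes a non-nilpotent
non-unit as a sum of units, so [udim R > 0]. On the other hand, for every
non-nilpotent [a], the product [x a = (1 + x a) - 1] is a non-nilpotent sum of
units, so [a] lies in the saturation of [W_1]; hence every element of the
localization at [W_1] is a unit or nilpotent. *)

(** * Ideals, maximal ideals and units *)

Lemma idealP (R : comNzRingType) (I : set R) :
  idealr_closed [in I] <->
  [/\ I 0, ~ I 1 & forall a u v, I u -> I v -> I (a * u + v)].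
Proof.
split=> [[I0 I1 IM]|[I0 I1 IM]]; split.
- by rewrite inE in I0.
- by move=> h; move/negP: I1; apply; rewrite inE.
- by move=> a u v; have := IM a u v; rewrite !inE.
- by rewrite inE.
- by apply/negP; rewrite inE.
- by move=> a u v; rewrite !inE; apply: IM.
Qed.

Lemma idealM (R : comNzRingType) (I : set R) (a x : R) :
  idealr_closed [in I] -> I x -> I (a * x).
Proof. by move=> /idealP[I0 _ IM] Ix; rewrite -[_ * _]addr0; apply: IM. Qed.

Lemma primeP (R : comNzRingType) (P : set R) (a b : R) :
  prime_ideal P -> P (a * b) -> P a \/ P b.
Proof.
by case=> _ Pp; have := Pp a b; rewrite !inE => h /h /orP[]; rewrite inE; tauto.
Qed.

Lemma nilradical_sub_prime (R : comNzRingType) (P : set R) :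
  prime_ideal P -> nilradical R `<=` P.
Proof.
move=> Pp x [n]; have /idealP[P0 P1 _] := Pp.1.
elim: n => [|n IH] xn.
  by case: P1; rewrite -(expr0 x) xn.
have : P (x ^+ n.+1) by rewrite xn.
elim: n.+1 => [|k IHk]; first by rewrite expr0.
by rewrite exprS => /(primeP _ _ _ _ Pp)[].
Qed.

Lemma exists_maximal_ideal (R : comNzRingType) (I : set R) :
  idealr_closed [in I] -> exists2 M, maximal_ideal M & I `<=` M.
Proof.
move=> Iid; have /idealP[I0 I1 IM] := Iid.
(* The empty set is admitted because the empty chain has empty union. *)
pose P (J : set R) := [/\ ~ J 1, forall a u v, J u -> J v -> J (a * u + v)
  & J !=set0 -> I `<=` J].
have PI : P I by split=> // _ y.
have [|M [[M1 MM MI] Mmax]] := @Zorn_bigcup R P.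
  move=> F FP Ftot; split.
  - by case=> J FJ J1; case: (FP J FJ) => /(_ J1).
  - move=> a u v [J FJ Ju] [K FK Kv].
    have [JK|KJ] := Ftot J K FJ FK.
      by exists K => //; case: (FP K FK) => _ + _; apply => //; apply: JK.
    by exists J => //; case: (FP J FJ) => _ + _; apply => //; apply: KJ.
  - case=> y [J FJ Jy] z Iz; exists J => //.
    by case: (FP J FJ) => _ _ /(_ (ex_intro _ y Jy)); apply.
(* An empty [M] would not be maximal, since [I] would strictly contain it. *)
have IsubM : I `<=` M.
  have [/MI//|Mempty] := pselect (M !=set0).
  case: (Mmax I) => //; split=> [y My|/(_ 0 I0) M0]; case: Mempty.
    by exists y.
  by exists 0.
exists M => //; split; first by apply/idealP; split=> //; apply: IsubM.
move=> J /idealP[J0 J1 JM] MJ; apply: contrapT => JnM.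
apply: (Mmax J).
  by split=> // JsubM; apply: JnM; apply/seteqP.
by split=> // _ y Iy; apply/MJ/IsubM.
Qed.

(** A non-unit generates a proper ideal, which some maximal ideal contains. *)
Lemma unit_of_maximal_ideals (R : comNzRingType) (x : R) :
  (forall M, maximal_ideal M -> ~ M x) -> is_unit x.
Proof.
move=> nMx; apply: contrapT => nux.
have [|M Mmax xM] := @exists_maximal_ideal R [set z | exists y, z = x * y].
  apply/idealP; split=> [|[y xy]|a _ _ [y ->] [z ->]].
  - by exists 0; rewrite mulr0.
  - by apply: nux; exists y.
  - by exists (a * y + z); ring.
by apply: (nMx M Mmax); apply: xM; exists 1; rewrite mulr1.
Qed.

Lemma maximal_ideal_prime (R : comNzRingType) (M : set R) :
  maximal_ideal M -> prime_ideal M.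
Proof.
move=> [Mid Mmax]; split=> // a b; rewrite !inE => Mab.
have /idealP[M0 M1 MM] := Mid.
apply/orP; rewrite !inE; have [|nMa] := pselect (M a); [by left|right].
(* [J] is [M + aR]. If it contains [1 = y + c a], multiplying by [b] gives [b] in [M]; otherwise
   maximality forces [J = M], hence [a] in [M]. *)
pose J : set R := [set z | exists y c, M y /\ z = y + c * a].
have MJ : M `<=` J by move=> y My; exists y, 0; rewrite mul0r addr0.
have [[y [c [My e]]]|J1] := pselect (J 1).
  rewrite -[b]mul1r e mulrDl addrC -mulrA; apply: MM => //.
  by rewrite mulrC; apply: idealM.
case: nMa; suff <- : J = M by exists 0, 1; rewrite mul1r add0r.
apply: Mmax => //; apply/idealP; split=> //; first exact: MJ.
move=> d _ _ [y [c [My ->]]] [y' [c' [My' ->]]].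
by exists (d * y + y'), (d * c + c'); split; [apply: MM|ring].
Qed.

Lemma unit1D_of_maximal_ideals (R : comNzRingType) (x : R) :
  (forall M, maximal_ideal M -> M x) -> forall r, is_unit (1 + x * r).
Proof.
move=> Mx r; apply: unit_of_maximal_ideals => M Mmax M1xr.
have /idealP[M0 M1 MM] := Mmax.1.
apply: M1; have -> : 1 = - r * x + (1 + x * r) by ring.
by apply: MM => //; apply: Mx.
Qed.

(** * Units and nilpotents in localizations *)

Section Fractions.
Variables (R : comPzRingType) (W : set R) (closedW : mulr_closed [in W]).

Lemma frac_den1X (a : R) n :
  frac closedW a (den1 closedW) ^+ n = frac closedW (a ^+ n) (den1 closedW).
Proof.
elim: n => [|n IH]; first by rewrite !expr0.
by rewrite exprS IH fracM; apply: frac_eq; rewrite /= exprS !mulr1.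
Qed.

Lemma frac_nilpotent (a : R) s :
  nilradical R a -> nilradical _ (frac closedW a s).
Proof.
case=> n an; exists n.
have -> : frac closedW a s =
    frac closedW a (den1 closedW) * frac closedW 1 s.
  by rewrite fracM; apply: frac_eq => /=; ring.
rewrite exprMn frac_den1X an.
by rewrite (_ : frac closedW 0 (den1 closedW) = 0) // mul0r.
Qed.

Lemma frac_is_unit (a : R) s : saturation W a -> is_unit (frac closedW a s).
Proof.
case=> y Way; exists (frac closedW (y * val s) (exist _ (a * y) (mem_set Way))).
by rewrite fracM frac1; apply: frac_eq => /=; ring.
Qed.

End Fractions.

Section TrivialLocalization.
Variables (R : comPzRingType) (closed1 : mulr_closed [in [set 1 : R]]).

(** This settles index 0, where [Wset] is [{1}]: sending [a] to [a / 1] is an injective morphism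
    that reaches every fraction, so units and nilpotents descend to [R]. *)
Lemma unit_additive_loc1 :
  unit_additive (localization closed1) -> unit_additive R.
Proof.
pose i a := frac closed1 a (den1 closed1).
have iI a b : i a = i b -> a = b.
  case/frac_eqP=> w -> /=; rewrite mul1r !mulr1 => /eqP.
  by rewrite subr_eq0 => /eqP.
have iM a b : i (a * b) = i a * i b.
  by rewrite fracM; apply: frac_eq; rewrite /= !mulr1.
have iD a b : i (a + b) = i a + i b.
  by rewrite fracD; apply: frac_eq; rewrite /= !mulr1.
have iU a : is_unit a -> is_unit (i a).
  by case=> b ab; exists (i b); rewrite -iM ab.
move=> ua x y /iU ux /iU uy; case: (ua _ _ ux uy); rewrite -iD.
  case=> q; have [z [s ->]] := fracP q => e; left; exists z; apply: iI.
  have s1 : val s = 1 by have := valP s; rewrite inE.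
  rewrite iM; transitivity (i (x + y) * frac closed1 z s); last exact: e.
  by congr (_ * _); apply: frac_eq; rewrite /= s1.
by case=> n; rewrite frac_den1X => e; right; exists n; apply: iI.
Qed.

End TrivialLocalization.

Lemma udim_eq1 (R : comNzRingType) (nilR : prime_ideal (nilradical R)) (x : R) :
  ~ nilradical R x -> (forall r, is_unit (1 + x * r)) -> udim nilR = Fin 1.
Proof.
move=> xnil xJ.
have uN1 : is_unit (-1 : R) by exists (-1); rewrite mulrNN mulr1.
apply/einf_FinP; split; last first.
  case=> // /unit_additive_loc1 ua; exfalso.
  have := ua _ _ (xJ 1) uN1; rewrite mulr1 addrAC subrr add0r => -[[y xy]|//].
  (* With [x y = 1], the unit [1 + x (- y)] would be 0. *)
  have [z] := xJ (- y); rewrite mulrN xy subrr mul0r => /esym/eqP.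
  by rewrite oner_eq0.
move=> p q _ _; have [a [s ->]] := fracP (p + q).
have [anil|anil] := pselect (nilradical R a).
  by right; apply: frac_nilpotent.
left; apply: frac_is_unit; exists x; split.
  by move=> /(primeP _ _ _ _ nilR)[].
exists [:: 1 + x * a; -1]; split; last first.
  by rewrite big_cons big_seq1; ring.
(* [saturation (Wset R 0)] unfolds to [is_unit]. *)
by move=> y; rewrite !inE => /orP[]/eqP->; [apply: xJ|apply: uN1].
Qed.

(** * Chains of primes and the Jacobson radical *)

Lemma epos_esup (E : set nat) : epos (esup E) -> exists2 n, E n & (0 < n)%N.
Proof.
move=> Epos; apply: contrapT => nE.
(* Without a positive element, 0 is an upper bound, even when [E] is empty. *)
suff e : esup E = Fin 0 by rewrite e in Epos.
apply/einf_FinP; split=> // n En; rewrite leqn0 -[_ == _]negbK -lt0n.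
by apply/negP => n0; apply: nE; exists n.
Qed.

(** The prime just below [C n] contains the nilradical, so an element of [C n] outside that prime is
    not nilpotent. *)
Lemma prime_ideal_chain_nonnil (R : comNzRingType) n (C : nat -> set R) :
  (0 < n)%N -> prime_chain n C -> exists2 x, C n x & ~ nilradical R x.
Proof.
case: n => // n _ [Cp Clt]; have [_ CnC] := Clt n (leqnn _).
apply: contrapT => h; apply: CnC => x Cx.
apply: (nilradical_sub_prime _ _ (Cp n (leqnSn n))).
by apply: contrapT => xnil; apply: h; exists x.
Qed.

(** Positive height gives a non-nilpotent element in each maximal ideal. The product of these
    finitely many elements lies in all of them and, the nilradical being prime, is not nilpotent. *)
Lemma semilocal_jacobson (R : comNzRingType) :
  prime_ideal (nilradical R) -> semilocal R ->
  (forall M : set R, maximal_ideal M -> epos (height M)) ->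
  exists2 x : R, ~ nilradical R x & forall M, maximal_ideal M -> M x.
Proof.
move=> nilR /finite_seqP[s sE] hpos.
have {}sE M : maximal_ideal M <-> M \in s.
  by have := congr1 (fun F => F M) sE => /= ->.
have smax M : M \in s -> maximal_ideal M by move/sE.
suff [x xnil xs] : exists2 x : R, ~ nilradical R x & forall M, M \in s -> M x.
  by exists x => // M /sE; apply: xs.
(* A tail of [s] no longer lists every maximal ideal, so the induction keeps only [smax]. *)
elim: s smax {sE} => [|M s IH] smax.
  by exists 1 => //; have /idealP[] := nilR.1.
have [|x xnil xs] := IH; first by move=> N Ns; apply: smax; rewrite inE Ns orbT.
have Mmax : maximal_ideal M by apply: smax; rewrite mem_head.
have [n [C [Cch CM]] n0] := epos_esup _ (hpos M Mmax).
have [y] := prime_ideal_chain_nonnil _ _ _ n0 Cch; rewrite CM => My ynil.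
exists (x * y); first by move=> /(primeP _ _ _ _ nilR)[].
move=> N; rewrite inE => /orP[/eqP->|Ns]; first exact: idealM Mmax.1 My.
rewrite mulrC; apply: idealM; last exact: xs.
by case: (smax N) => //; rewrite inE Ns orbT.
Qed.

Lemma G_domain_jacobson (R : comNzRingType) :
  G_domain R -> ~ is_field R ->
  exists2 x : R, ~ nilradical R x & forall M, maximal_ideal M -> M x.
Proof.
move=> [dom [x x0 xP]] nF; exists x.
  case; elim=> [|n IH]; first by move/eqP; rewrite expr0 oner_eq0.
  by rewrite exprS => /dom /orP[/eqP e|/eqP //]; rewrite e eqxx in x0.
move=> M Mmax; apply: xP; first exact: maximal_ideal_prime.
(* If the zero ideal were maximal, it would be the only maximal ideal, so every nonzero element
   would be a unit. *)
move=> M0; apply: nF => a a0; apply: unit_of_maximal_ideals => N Nmax Na.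
have N0 : N = [set 0].
  rewrite -M0; apply: Mmax.2; first exact: Nmax.1.
  by rewrite M0 => _ ->; have /idealP[] := Nmax.1.
by rewrite N0 /= in Na; rewrite Na eqxx in a0.
Qed.

(** * Units among power series *)

Section PowerSeriesUnits.
Variable A : comNzRingType.
Implicit Types f g : powerseries A.

Definition psX : powerseries A := PowerSeries (fun n => (n == 1%N)%:R).

Lemma coefs_psXM f n :
  coefs (psX * f) n = if n is k.+1 then coefs f k else 0.
Proof.
rewrite coefsM; case: n => [|n]; first by rewrite big_ord1 /= mul0r.
rewrite !big_ord_recl /= mul0r add0r mul1r subSS subn0 big1 ?addr0 // => i _.
by rewrite mul0r.
Qed.

Lemma psX_nonnil : ~ nilradical _ psX.
Proof.
have Xn n : coefs (psX ^+ n) n = 1.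
  by elim: n => [|n IH] //; rewrite exprS coefs_psXM.
case=> n e; have := Xn n; rewrite e /= mul0rn => /esym/eqP.
by rewrite oner_eq0.
Qed.

(* [geom h n] lists the coefficients of index [< n] of the inverse of
   [1 - X h]. *)
Fixpoint geom (h : nat -> A) (n : nat) : seq A :=
  if n is k.+1 then
    let s := geom h k in
    rcons s ((k == 0%N)%:R + \sum_(i < k) h i * nth 0 s (k.-1 - i)%N)
  else [::].

Lemma size_geom h n : size (geom h n) = n.
Proof. by elim: n => //= n IH; rewrite size_rcons IH. Qed.

(** Each list extends the previous one, so the recursion on lists becomes a recursion on the
    coefficients of the inverse. *)
Lemma nth_geom h n i : (i < n)%N -> nth 0 (geom h n) i = nth 0 (geom h i.+1) i.
Proof.
elim: n => // n IH; rewrite ltnS leq_eqVlt => /orP[/eqP->//|lt].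
by rewrite [LHS]/= nth_rcons size_geom lt IH.
Qed.

Lemma unit_1DpsXM f : is_unit (1 + psX * f).
Proof.
(* The sign rewrites [1 + X f] as [1 - X h]. *)
pose h i := - coefs f i.
pose g := PowerSeries (fun n => nth 0 (geom h n.+1) n).
exists g; rewrite mulrDl mul1r -mulrA; apply: coefsP => n.
rewrite coefsD coefs_psXM coefs1 [coefs g n]/= nth_rcons size_geom ltnn eqxx.
(* At index 0 the sum is empty; at index [n + 1] the recursion gives the coefficient of [- X f g],
   and the terms cancel in pairs. *)
case: n => [|n]; first by rewrite big_ord0 /= !addr0.
rewrite add0r coefsM -big_split big1 //= => i _.
by rewrite /h mulNr -(@nth_geom h n.+1) ?addNr // ltnS leq_subr.
Qed.

End PowerSeriesUnits.

(** * Subrings of a local ring *)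

Lemma local_subring_jacobson (R T : comNzRingType) (m : set T)
    (f : {rmorphism R -> T}) :
  local_ring T m -> epos (krull_dim T) -> injective f -> m `<=` range f ->
  exists2 x : R, ~ nilradical R x & forall r, is_unit (1 + x * r).
Proof.
move=> Tloc Tdim finj mR.
have maxE N : maximal_ideal N <-> N = m.
  by have := congr1 (fun F => F N) Tloc => /= ->.
have mmax : maximal_ideal m by apply/maxE.
have [n [C Cch] n0] := epos_esup _ Tdim.
have [y Cy ynil] := prime_ideal_chain_nonnil _ _ _ n0 Cch.
(* The top prime of the chain lies in some maximal ideal, which can only be [m]. *)
have my : m y.
  have [M /maxE-> ] := @exists_maximal_ideal T (C n) (Cch.1 n (leqnn n)).1.
  exact.
have [x _ xy] := mR y my; exists x.
  by case=> k xk; apply: ynil; exists k; rewrite -xy -rmorphXn xk rmorph0.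
move=> r.
have [|z fz] := @unit1D_of_maximal_ideals T y _ (f r); first by move=> M /maxE->.
(* The inverse of [1 + y r] in [T] is [1 - z r y], and [z r y] lies in [m]. *)
have [t _ ft] : range f (z * f r * y) by apply: mR; apply: idealM mmax.1 my.
exists (1 - t); apply: finj.
rewrite rmorphM rmorphD rmorphB rmorphM rmorph1 ft xy.
transitivity (1 + y * f r - y * f r * ((1 + y * f r) * z)); first by ring.
by rewrite fz; ring.
Qed.

Theorem corollary7p2 (R : comNzRingType) (nilR : prime_ideal (nilradical R)) :
  [\/ semilocal R /\ (forall M : set R, maximal_ideal M -> epos (height M)),
      G_domain R /\ ~ is_field R,
      exists (A : comNzRingType) (f : {rmorphism R -> powerseries A}),
        bijective f
    | exists (T : comNzRingType) (m : set T) (f : {rmorphism R -> T}),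
        [/\ local_ring T m, epos (krull_dim T), injective f & m `<=` range f]] ->
  udim nilR = Fin 1.
Proof.
case=> [[sl hpos]|[Gd nF]|[A [f [g fK gK]]]|[T [m [f [Tloc Tdim finj mR]]]]].
- have [x xnil /unit1D_of_maximal_ideals] := semilocal_jacobson R nilR sl hpos.
  exact: udim_eq1.
- have [x xnil /unit1D_of_maximal_ideals] := G_domain_jacobson R Gd nF.
  exact: udim_eq1.
(* The preimage of [X] under the isomorphism serves as [x]. *)
- have finj := can_inj fK.
  apply: (@udim_eq1 _ _ (g (psX A))).
    case=> n e; apply: (psX_nonnil A); exists n.
    by rewrite -[psX A]gK -rmorphXn e rmorph0.
  move=> r; have [h fh] := unit_1DpsXM A (f r); exists (g h); apply: finj.
  by rewrite rmorphM rmorphD rmorphM rmorph1 !gK.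
- have [x xnil xJ] := local_subring_jacobson R T m f Tloc Tdim finj mR.
  exact: udim_eq1 xJ.
Qed.
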